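(* Let $X$ be a manifold with an almost $s$-Kähler structure of rank two, $s\ge 2$. The bundle of real Lie algebras $\mathbf{s}\mathcal{L}^s$ has fibre isomorphic to the Lie algebra $\mathbf{sl}(2s+2,\mathbb{R})$.
   Context: Fix $s\ge 2$. An almost $s$-Kähler structure of rank two on a smooth manifold $X$ of dimension $2(s+1)$ consists of a Riemannian metric $\mathbf{g}$ and smooth two-forms $\omega_{jk}$, $j,k\in\{0,\dots,s\}$, such that: (i) $\omega_{01},\dots,\omega_{0s}$ are closed and around every point there are coordinates $x_1,x_2,y^j_1,y^j_2$ ($1\le j\le s$) with $\omega_{0j}=\sum_{i=1}^2 dx_i\wedge dy^j_i$ for all $j$; (ii) at every $p\in X$ there is an orthonormal basis $\{v_{ij}: i=1,2,\ j=0,\dots,s\}$ of $T^*_pX$ (an adapted coframe) with $\omega_{jk}=\sum_{i=1}^2 v_{ij}\wedge v_{ik}$ at $p$ for all $j,k$. Any two adapted coframes at $p$ are related by $v'_{ij}=\sum_l a_{il}v_{lj}$ with $(a_{il})\in \mathbf{O}(2)$; so the spaces $W_j=\langle v_{1j},v_{2j}\rangle$ are canonical. On $\bigwedge^*_{\mathbb{C}}T^*_pX$ let $E_{ij}$ be the wedge product with $v_{ij}$; $*$ denotes the adjoint with respect to the Hermitian metric induced by $\mathbf{g}$. Put, for $j\neq k$, $L_{jk}=\sum_{i=1}^2E_{ij}E_{ik}$ (wedge with $\omega_{jk}$), $V_j=E_{1j}E_{2j}$ (wedge with the volume form of $W_j$, defined up to a sign common to all $j$ which is fixed by choosing an orientation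 of $W_0$), $\Lambda_{jk}=L_{jk}^*$, $A_j=V_j^*$. $\mathbf{s}\mathcal{L}^s$ is the bundle of real Lie algebras (commutator bracket) whose fibre at $p$ is the real Lie subalgebra of $\mathrm{End}_{\mathbb{C}}(\bigwedge^*_{\mathbb{C}}T_p^*X)$ generated by all $L_{jk},\ \sqrt{-1}\,V_j,\ \Lambda_{jk},\ \sqrt{-1}\,A_j$ (this is independent of the choice of sign). *)

(* Defs.v *)
From HB Require Import structures.
From mathcomp Require Import all_boot all_order all_algebra.
From mathcomp Require Import all_classical all_reals all_analysis.
From mathcomp Require Import complex.

Set Implicit Arguments.
Unset Strict Implicit.
Unset Printing Implicit Defensive.

Import Order.TTheory GRing.Theory Num.Theory.
Import numFieldNormedType.Exports.

Local Open Scope classical_set_scope.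
Local Open Scope ring_scope.

(** * Smooth manifolds, by maximal atlases *)

Definition iter_partial (R : realType) (n : nat) (l : seq 'I_n)
    (f : 'rV[R]_n -> R) : 'rV[R]_n -> R :=
  foldr (fun a h => fun x => 'D_(delta_mx 0 a) h x) f l.

(* On an open set U this is C^oo: the iterated partial derivatives of all
   orders exist on U and, being differentiable, are continuous. *)
Definition smooth_on (R : realType) (n : nat) (U : set 'rV[R]_n)
    (f : 'rV[R]_n -> R) : Prop :=
  forall (l : seq 'I_n) (x : 'rV[R]_n), U x ->
    differentiable (iter_partial l f) x.

(* [cmap] and [cinv] are total functions; only their values on [cdom] and on
   [ccod] are meaningful. *)
Record chart (R : realType) (n : nat) (X : topologicalType) := Chart {
  cdom : set X;
  cmap : X -> 'rV[R]_n;
  cinv : 'rV[R]_n -> X;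
  cdom_open : open cdom;
  ccod_open : open (cmap @` cdom);
  cmap_continuous : {in cdom, continuous cmap};
  cinv_continuous : {in cmap @` cdom, continuous cinv};
  cmapK : {in cdom, cancel cmap cinv} }.

Definition ccod (R : realType) (n : nat) (X : topologicalType)
  (c : chart R n X) : set 'rV[R]_n := cmap c @` cdom c.

Definition transition (R : realType) (n : nat) (X : topologicalType)
  (c c' : chart R n X) : 'rV[R]_n -> 'rV[R]_n := cmap c' \o cinv c.

Definition smooth_transition (R : realType) (n : nat) (X : topologicalType)
    (c c' : chart R n X) : Prop :=
  forall a : 'I_n,
    smooth_on (cmap c @` (cdom c `&` cdom c')) (fun x => transition c c' x 0 a).

Definition compatible_charts (R : realType) (n : nat) (X : topologicalType)
    (c c' : chart R n X) : Prop :=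
  smooth_transition c c' /\ smooth_transition c' c.

Record manifold (R : realType) (n : nat) := Manifold {
  mspace :> topologicalType;
  mhausdorff : hausdorff_space mspace;
  msecond_countable : @second_countable mspace;
  atlas : set (chart R n mspace);
  atlas_cover : forall p : mspace, exists2 c, atlas c & cdom c p;
  atlas_compatible : forall c c', atlas c -> atlas c' -> compatible_charts c c';
  atlas_maximal : forall c,
    (forall c', atlas c' -> compatible_charts c c') -> atlas c }.

(** * Tensors of type (0,2)

   A chart [c] around [p] identifies the tangent and the cotangent space at
   [p] with row vectors (coordinates in the bases of the d/dx_a, resp. of the
   dx_a).  A tensor field T assigns to every chart of the atlas and every
   point the matrix T(d/dx_a, d/dx_b).  The matrix [jacobian f x] acts on row
   vectors from the right, i.e. has entry (a, b) equal to d f_b / d x_a. *)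

Definition tensor02 (R : realType) (n : nat) (X : manifold R n) : Type :=
  chart R n X -> X -> 'M[R]_n.

Definition covariant (R : realType) (n : nat) (X : manifold R n)
    (T : tensor02 X) : Prop :=
  forall (c c' : chart R n X) (p : X),
    atlas c -> atlas c' -> cdom c p -> cdom c' p ->
    let J := jacobian (transition c c') (cmap c p) in
    T c p = J *m T c' p *m J^T.

Definition smooth_tensor (R : realType) (n : nat) (X : manifold R n)
    (T : tensor02 X) : Prop :=
  forall (c : chart R n X) (a b : 'I_n),
    atlas c -> smooth_on (ccod c) (fun x => T c (cinv c x) a b).

Definition riemannian_metric (R : realType) (n : nat) (X : manifold R n)
    (g : tensor02 X) : Prop :=
  [/\ covariant g, smooth_tensor g &
      forall (c : chart R n X) (p : X), atlas c -> cdom c p ->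
        (g c p)^T = g c p /\
        forall u : 'rV[R]_n, u != 0 -> 0 < (u *m g c p *m u^T) 0 0].

(* A two-form is written sum_(a < b) T_ab dx_a /\ dx_b, with T antisymmetric. *)
Definition two_form (R : realType) (n : nat) (X : manifold R n)
    (T : tensor02 X) : Prop :=
  [/\ covariant T, smooth_tensor T &
      forall (c : chart R n X) (p : X), atlas c -> cdom c p ->
        (T c p)^T = - T c p].

Definition closed_form (R : realType) (n : nat) (X : manifold R n)
    (T : tensor02 X) : Prop :=
  forall (c : chart R n X) (a b d : 'I_n) (x : 'rV[R]_n),
    atlas c -> ccod c x ->
    let partial (k i j : 'I_n) :=
      'D_(delta_mx 0 k) (fun y : 'rV[R]_n => T c (cinv c y) i j) x in
    partial a b d + partial b d a + partial d a b = 0.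

Definition wedge1 (R : realType) (n : nat) (v w : 'rV[R]_n) : 'M[R]_n :=
  v^T *m w - w^T *m v.

(** * Almost s-Kaehler structures of rank two

   Coordinates on R^(2(s+1)) are indexed by pairs (i, j), i in {1, 2} (here
   'I_2) and j in {0, ..., s}, through [mxvec_index]: the pair (i, 0) stands
   for x_i, and (i, j) with j >= 1 for y^j_i. *)

Definition dcoord (R : realType) (s : nat) (i : 'I_2) (j : 'I_s.+1) :
  'rV[R]_(2 * s.+1) := delta_mx 0 (mxvec_index i j).

Definition cometric (R : realType) (n : nat) (G : 'M[R]_n) (v w : 'rV[R]_n) : R :=
  (v *m invmx G *m w^T) 0 0.

(* Orthonormality makes the 2(s+1) covectors v_ij a basis, by dimension. *)
Definition adapted (R : realType) (s : nat) (G : 'M[R]_(2 * s.+1))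
    (W : 'I_s.+1 -> 'I_s.+1 -> 'M[R]_(2 * s.+1))
    (v : 'I_2 -> 'I_s.+1 -> 'rV[R]_(2 * s.+1)) : Prop :=
  (forall i j i' j',
     cometric G (v i j) (v i' j') = ((i == i') && (j == j'))%:R) /\
  (forall j k, W j k = \sum_i wedge1 (v i j) (v i k)).

Record almost_sKahler (R : realType) (s : nat) (X : manifold R (2 * s.+1)) :=
    AlmostSKahler {
  metric : tensor02 X;
  omega : 'I_s.+1 -> 'I_s.+1 -> tensor02 X;
  metricP : riemannian_metric metric;
  omega_form : forall j k, two_form (omega j k);
  omega_closed : forall j : 'I_s.+1, j != ord0 -> closed_form (omega ord0 j);
  omega_coordinates : forall p : X, exists c : chart R (2 * s.+1) X,
    [/\ atlas c, cdom c p &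
        forall (j : 'I_s.+1) (q : X), j != ord0 -> cdom c q ->
          omega ord0 j c q = \sum_i wedge1 (dcoord R i ord0) (dcoord R i j)];
  adapted_ex : forall (c : chart R (2 * s.+1) X) (p : X),
    atlas c -> cdom c p ->
    exists v, adapted (metric c p) (fun j k => omega j k c p) v }.

Definition adapted_coframe (R : realType) (s : nat) (X : manifold R (2 * s.+1))
    (K : almost_sKahler X) (c : chart R (2 * s.+1) X) (p : X)
    (v : 'I_2 -> 'I_s.+1 -> 'rV[R]_(2 * s.+1)) : Prop :=
  adapted (metric K c p) (fun j k => omega K j k c p) v.

(** * The complexified exterior algebra of the cotangent space

   x : ext R n stands for the sum over I of x(I) dx_I, where dx_I is the
   product of the dx_a, a in I, in increasing order. *)

Definition ext (R : realType) (n : nat) : vectType R[i] :=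
  {ffun {set 'I_n} -> (R[i])^o}.

Definition wedge_fun (R : realType) (n : nat) (v : 'rV[R]_n) (x : ext R n) :
    ext R n :=
  [ffun I : {set 'I_n} =>
    \sum_(a in I) (-1) ^+ #|[set b in I | (b < a)%N]| * (v 0 a)%:C%C * x (I :\ a)].

Fact wedge_fun_linear (R : realType) (n : nat) (v : 'rV[R]_n) :
  linear (@wedge_fun R n v).
Proof.
move=> a x y; apply/ffunP => I; rewrite !ffunE scaler_sumr -big_split /=.
apply: eq_bigr => b _; rewrite !ffunE /= mulrDr; congr (_ + _).
by rewrite scalerAr.
Qed.

HB.instance Definition _ (R : realType) (n : nat) (v : 'rV[R]_n) :=
  GRing.isLinear.Build R[i] (ext R n) (ext R n) _ (wedge_fun v)
    (@wedge_fun_linear R n v).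

Definition wedge (R : realType) (n : nat) (v : 'rV[R]_n) : 'End(ext R n) :=
  linfun (wedge_fun v).

(* <dx_I, dx_J> = det (<dx_a, dx_b>), a in I, b in J, if |I| = |J|, and 0
   otherwise; [enum] lists the elements of a subset of 'I_n increasingly, and
   the default value of [nth] is not used. *)
Definition gram (R : realType) (n : nat) (G : 'M[R]_n) (I J : {set 'I_n}) : R :=
  if #|I| == #|J| then
    \det (\matrix_(k < #|I|, l < #|I|)
            invmx G (enum_val k) (nth (enum_val k) (enum J) l))
  else 0.

Definition herm (R : realType) (n : nat) (G : 'M[R]_n) (x y : ext R n) : R[i] :=
  \sum_(I : {set 'I_n}) \sum_(J : {set 'I_n})
    x I * ((y J)^*)%C * (gram G I J)%:C%C.

Definition adj (R : realType) (n : nat) (G : 'M[R]_n) (f : 'End(ext R n)) :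
    'End(ext R n) :=
  xget 0 [set f' : 'End(ext R n) |
            forall x y, herm G (f x) y = herm G x (f' y)].

(** * The Lie algebra at a point *)

Definition lie_subalgebra (R : realType) (n : nat) (S : set 'End(ext R n)) :
    Prop :=
  [/\ S 0,
      forall f h, S f -> S h -> S (f + h),
      forall (r : R) f, S f -> S (r%:C%C *: f) &
      forall f h, S f -> S h -> S ((f \o h)%VF - (h \o f)%VF)].

Definition opL (R : realType) (s : nat)
    (v : 'I_2 -> 'I_s.+1 -> 'rV[R]_(2 * s.+1)) (j k : 'I_s.+1) :
    'End(ext R (2 * s.+1)) :=
  \sum_i (wedge (v i j) \o wedge (v i k))%VF.

Definition opV (R : realType) (s : nat)
    (v : 'I_2 -> 'I_s.+1 -> 'rV[R]_(2 * s.+1)) (j : 'I_s.+1) :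
    'End(ext R (2 * s.+1)) :=
  (wedge (v ord0 j) \o wedge (v ord_max j))%VF.

Definition sL_generators (R : realType) (s : nat) (G : 'M[R]_(2 * s.+1))
    (v : 'I_2 -> 'I_s.+1 -> 'rV[R]_(2 * s.+1)) : set 'End(ext R (2 * s.+1)) :=
  [set f | (exists j k, j != k /\ (f = opL v j k \/ f = adj G (opL v j k))) \/
           (exists j, f = ('i)%C *: opV v j \/ f = ('i)%C *: adj G (opV v j))].

(* The fibre at p, computed in the chart c.  The adapted coframe v fixes the
   common sign of the V_j. *)
Definition sL_fibre (R : realType) (s : nat) (X : manifold R (2 * s.+1))
    (K : almost_sKahler X) (c : chart R (2 * s.+1) X) (p : X)
    (v : 'I_2 -> 'I_s.+1 -> 'rV[R]_(2 * s.+1)) : set 'End(ext R (2 * s.+1)) :=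
  smallest (@lie_subalgebra R (2 * s.+1)) (sL_generators (metric K c p) v).

Definition sl (R : realType) (m : nat) : set 'M[R]_m := [set A | \tr A = 0].
Arguments sl R m : clear implicits.

Definition lie_isomorphic_sl (R : realType) (n m : nat)
    (S : set 'End(ext R n)) : Prop :=
  exists phi : 'M[R]_m -> 'End(ext R n),
    [/\ set_bij (sl R m) S phi,
        forall A B, sl R m A -> sl R m B -> phi (A + B) = phi A + phi B,
        forall (r : R) A, sl R m A -> phi (r *: A) = r%:C%C *: phi A &
        forall A B, sl R m A -> sl R m B ->
          phi (A *m B - B *m A) = (phi A \o phi B)%VF - (phi B \o phi A)%VF].

(* Main.v *)
(* In a coframe adapted at p the wedge products E_ij and their adjoints C_ij
   satisfy the canonical anticommutation relations {C_ij, E_kl} = delta.  Put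
     e_j = E_1j + i E_2j,        f_j = (E_1j - i E_2j)/2,
     e*_j = (C_1j - i C_2j)/2,   f*_j = C_1j + i C_2j.
   The families (e_j, f*_j) and (e*_j, f_j) of 2s+2 operators each are again
   creation and annihilation operators a_m, b_m, so the real span of the
   a_m b_n is a copy of gl(2s+2, R), with a_m b_n as matrix units.  In it
     L_jk = e_j f_k - e_k f_j,          i V_j = - e_j f_j,
     Lambda_jk = f*_k e*_j - f*_j e*_k,  i A_j = f*_j e*_j
   are traceless.  Conversely, up to sign, [i V_j, Lambda_jk] is
   e_j e*_k + f*_k f_j while, for a third index l, [L_jl, Lambda_lk] is
   e_j e*_k - f*_k f_j; this is where s >= 2 enters.  Hence e_j e*_k and
   f*_k f_j are generated for j != k, then all off-diagonal a_m b_n, and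
   with their brackets all of sl(2s+2, R). *)
Require Import Defs.
From HB Require Import structures.
From mathcomp Require Import all_boot all_order all_algebra.
From mathcomp Require Import all_classical all_reals all_analysis.
From mathcomp Require Import complex ring.

Set Implicit Arguments.
Unset Strict Implicit.
Unset Printing Implicit Defensive.

Import Order.TTheory GRing.Theory Num.Theory.

Local Open Scope ring_scope.

(** * Exterior and interior products *)

Lemma linear_comb_comp (K : comNzRingType) (U : lmodType K) (m : nat)
    (f g : 'I_m -> {linear U -> U}) (v w : 'I_m -> K) (x : U) :
  \sum_a v a *: f a (\sum_b w b *: g b x) =
  \sum_a \sum_b (v a * w b) *: f a (g b x).
Proof.
apply: eq_bigr => a _; rewrite linear_sum scaler_sumr.
by apply: eq_bigr => b _; rewrite linearZ scalerA.
Qed.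

Section ExteriorOperators.
Variables (R : realType) (n : nat).
Implicit Types (x y : ext R n) (I : {set 'I_n}) (a b : 'I_n).

(** The sign of moving dx_a past the factors of dx_I with smaller index. As a itself is not counted,
    the sign is the same for I with or without a. *)
Definition koszul a I : R[i] := (-1) ^+ #|[set b in I | (b < a)%N]|.

Definition ext_mul a x : ext R n :=
  [ffun I : {set 'I_n} => (a \in I)%:R * koszul a I * x (I :\ a)].

(** Contraction with d/dx_a: the coefficient at I comes from the one at I with a inserted, with the
    sign that [ext_mul] uses. *)
Definition ext_contr a x : ext R n :=
  [ffun I : {set 'I_n} => (a \notin I)%:R * koszul a I * x (a |: I)].

Fact ext_mul_linear a : linear (ext_mul a).
Proof.
move=> k x y; apply/ffunP => I; rewrite !ffunE /= mulrDr; congr (_ + _).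
exact: scalerAr.
Qed.

Fact ext_contr_linear a : linear (ext_contr a).
Proof.
move=> k x y; apply/ffunP => I; rewrite !ffunE /= mulrDr; congr (_ + _).
exact: scalerAr.
Qed.

HB.instance Definition _ a :=
  GRing.isLinear.Build R[i] (ext R n) (ext R n) _ (ext_mul a)
    (ext_mul_linear a).

HB.instance Definition _ a :=
  GRing.isLinear.Build R[i] (ext R n) (ext R n) _ (ext_contr a)
    (ext_contr_linear a).

Lemma koszulU1 a b I : b \notin I ->
  koszul a (b |: I) = (-1) ^+ (b < a)%N * koszul a I.
Proof.
move=> bI; rewrite /koszul -exprD; congr (_ ^+ _).
rewrite (cardsD1 b) !inE eqxx /=; congr (_ + _)%N.
apply: eq_card => c; rewrite !inE.
by case: eqVneq => // ->; rewrite (negPf bI).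
Qed.

Lemma koszulD1 a b I : b \in I ->
  koszul a (I :\ b) = (-1) ^+ (b < a)%N * koszul a I.
Proof.
move=> bI; rewrite -[in RHS](finset.setD1K bI) koszulU1 ?finset.setD11 //.
by rewrite mulrA -expr2 sqrr_sign mul1r.
Qed.

(** Exactly one of a < b and b < a holds; every sign in the anticommutation relations below comes
    from this. *)
Lemma sign_ltn_swap a b (z : R[i]) : a != b ->
  (-1) ^+ (b < a)%N * z = - ((-1) ^+ (a < b)%N * z).
Proof.
rewrite -val_eqE /=; case: ltngtP => //= _ _;
  by rewrite expr0 expr1 mulN1r ?mul1r ?opprK.
Qed.

Lemma ext_mulC a b x : ext_mul a (ext_mul b x) = - ext_mul b (ext_mul a x).
Proof.
apply/ffunP => I; rewrite !ffunE !inE.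
have [-> | ab] := eqVneq a b; first by rewrite !(mul0r, mulr0) oppr0.
rewrite /=.
have [aI | aI] := boolP (a \in I); last by rewrite !(mul0r, mulr0) oppr0.
have [bI | bI] := boolP (b \in I); last by rewrite !(mul0r, mulr0) oppr0.
rewrite !mul1r !koszulD1 // !mulrA.
rewrite (mulrC (koszul a I)) -!mulrA sign_ltn_swap 1?eq_sym //; congr (- _).
rewrite !mulrA (mulrC (koszul b I)) -!mulrA; congr (_ * _).
by rewrite mulrCA finset.setDDl finset.setUC -finset.setDDl.
Qed.

Lemma ext_contrC a b x :
  ext_contr a (ext_contr b x) = - ext_contr b (ext_contr a x).
Proof.
apply/ffunP => I; rewrite !ffunE !inE !negb_or.
have [-> | ab] := eqVneq a b; first by rewrite !(mul0r, mulr0) oppr0.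
rewrite /=.
have [aI | aI] := boolP (a \in I); first by rewrite !(mul0r, mulr0) oppr0.
have [bI | bI] := boolP (b \in I); first by rewrite !(mul0r, mulr0) oppr0.
rewrite !mul1r !koszulU1 // !mulrA.
rewrite (mulrC (koszul a I)) -!mulrA sign_ltn_swap 1?eq_sym //; congr (- _).
rewrite !mulrA (mulrC (koszul b I)) -!mulrA; congr (_ * _).
by rewrite mulrCA finset.setUCA.
Qed.

(** For a = b exactly one of the two products contributes at I, depending on whether b lies in I,
    and its sign is squared. For distinct a and b the signs differ by [sign_ltn_swap]. *)
Lemma ext_contr_mul a b x :
  ext_contr a (ext_mul b x) = (a == b)%:R *: x - ext_mul b (ext_contr a x).
Proof.
apply/ffunP => I; rewrite !ffunE /= !inE.
have [-> | ab] := eqVneq a b.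
  rewrite scale1r /=.
  have [bI | bI] := boolP (b \in I).
    rewrite koszulD1 // finset.setD1K // ltnn expr0 !mul1r !mul0r.
    by rewrite mulrA -expr2 sqrr_sign mul1r subrr.
  rewrite koszulU1 // finset.setU1K // ltnn expr0 !mul1r !mul0r subr0.
  by rewrite mulrA -expr2 sqrr_sign mul1r.
rewrite scale0r add0r /=.
have [aI | aI] := boolP (a \in I); first by rewrite !(mul0r, mulr0) oppr0.
have [bI | bI] := boolP (b \in I); last by rewrite !(mul0r, mulr0) oppr0.
rewrite !mul1r koszulU1 // koszulD1 // !mulrA.
rewrite (mulrC (koszul a I)) -!mulrA sign_ltn_swap 1?eq_sym //; congr (- _).
rewrite !mulrA (mulrC (koszul b I)) -!mulrA; congr (_ * _).
rewrite mulrCA; congr (_ * (_ * x _)).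
by apply/setP => c; rewrite !inE; case: (eqVneq c a) => // ->; rewrite ab.
Qed.

(** Contraction with the tangent vector whose coordinates in the basis d/dx_a are u. *)
Definition contr_fun (u : 'rV[R]_n) x : ext R n :=
  \sum_a (u 0 a)%:C%C *: ext_contr a x.

Fact contr_fun_linear u : linear (contr_fun u).
Proof.
move=> k x y; rewrite /contr_fun scaler_sumr -big_split.
apply: eq_bigr => a _ /=.
by rewrite linearP scalerDr !scalerA mulrC.
Qed.

HB.instance Definition _ u :=
  GRing.isLinear.Build R[i] (ext R n) (ext R n) _ (contr_fun u)
    (contr_fun_linear u).

Definition contr u : 'End(ext R n) := linfun (contr_fun u).

Lemma contrE u x : contr u x = \sum_a (u 0 a)%:C%C *: ext_contr a x.
Proof. exact: lfunE. Qed.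

Lemma wedgeE (u : 'rV[R]_n) x : wedge u x = \sum_a (u 0 a)%:C%C *: ext_mul a x.
Proof.
rewrite lfunE; apply/ffunP => I /=; rewrite !ffunE sum_ffunE big_mkcond /=.
apply: eq_bigr => a _; rewrite !ffunE /=.
case: ifP => _; last by rewrite !mul0r scaler0.
by rewrite mul1r -/(koszul a I) (mulrC (koszul a I)) -mulrA.
Qed.


Let mul_l (a : 'I_n) : {linear ext R n -> ext R n} := ext_mul a.
Let contr_l (a : 'I_n) : {linear ext R n -> ext R n} := ext_contr a.

Fact wedge_wedgeE (v w : 'rV[R]_n) x : wedge v (wedge w x) =
  \sum_a \sum_b ((v 0 a)%:C%C * (w 0 b)%:C%C) *: ext_mul a (ext_mul b x).
Proof. rewrite wedgeE wedgeE; exact: (linear_comb_comp mul_l mul_l). Qed.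

Fact wedge_contrE (v w : 'rV[R]_n) x : wedge v (contr w x) =
  \sum_a \sum_b ((v 0 a)%:C%C * (w 0 b)%:C%C) *: ext_mul a (ext_contr b x).
Proof. rewrite wedgeE contrE; exact: (linear_comb_comp mul_l contr_l). Qed.

Fact contr_wedgeE (v w : 'rV[R]_n) x : contr v (wedge w x) =
  \sum_a \sum_b ((v 0 a)%:C%C * (w 0 b)%:C%C) *: ext_contr a (ext_mul b x).
Proof. rewrite contrE wedgeE; exact: (linear_comb_comp contr_l mul_l). Qed.

Fact contr_contrE (v w : 'rV[R]_n) x : contr v (contr w x) =
  \sum_a \sum_b ((v 0 a)%:C%C * (w 0 b)%:C%C) *: ext_contr a (ext_contr b x).
Proof. rewrite contrE contrE; exact: (linear_comb_comp contr_l contr_l). Qed.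

Lemma wedge_comp (v w : 'rV[R]_n) :
  (wedge v \o wedge w)%VF = - (wedge w \o wedge v)%VF.
Proof.
apply/lfunP => x; rewrite opp_lfunE !comp_lfunE !wedge_wedgeE.
rewrite exchange_big /= -sumrN; apply: eq_bigr => b _.
rewrite -sumrN; apply: eq_bigr => a _.
by rewrite ext_mulC scalerN mulrC.
Qed.

Lemma contr_comp (v w : 'rV[R]_n) :
  (contr v \o contr w)%VF = - (contr w \o contr v)%VF.
Proof.
apply/lfunP => x; rewrite opp_lfunE !comp_lfunE !contr_contrE.
rewrite exchange_big /= -sumrN; apply: eq_bigr => b _.
rewrite -sumrN; apply: eq_bigr => a _.
by rewrite ext_contrC scalerN mulrC.
Qed.

Lemma contr_wedge (u v : 'rV[R]_n) :
  (contr u \o wedge v)%VF =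
  ((u *m v^T) 0 0)%:C%C *: \1%VF - (wedge v \o contr u)%VF.
Proof.
apply/lfunP => x; rewrite add_lfunE opp_lfunE scale_lfunE id_lfunE !comp_lfunE.
rewrite contr_wedgeE wedge_contrE.
rewrite [in RHS]exchange_big /= mxE rmorph_sum scaler_suml -sumrB.
apply: eq_bigr => a _.
transitivity (\sum_b (((u 0 a)%:C%C * (v 0 b)%:C%C * (a == b)%:R) *: x -
   ((v 0 b)%:C%C * (u 0 a)%:C%C) *: ext_mul b (ext_contr a x))).
  apply: eq_bigr => b _.
  by rewrite ext_contr_mul scalerBr scalerA (mulrC (v 0 b)%:C%C).
rewrite sumrB; congr (_ - _).
rewrite (bigD1 a) //= eqxx mulr1 big1 ?addr0 => [|b ba].
  by rewrite mxE rmorphM.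
by rewrite eq_sym (negPf ba) mulr0 scale0r.
Qed.

End ExteriorOperators.

(** * Laplace expansion of the Gram determinants *)

Lemma index_sorted_ltn (s : seq nat) (a : nat) :
  sorted ltn s -> a \in s -> index a s = count (ltn^~ a) s.
Proof.
elim: s => //= b s IHs ps; have bs := order_path_min ltn_trans ps.
rewrite inE eq_sym => /orP[/eqP ba | a_s].
  rewrite -ba eqxx ltnn add0n; apply/esym/eqP; rewrite eqn0Ngt -has_count.
  by apply/hasPn => c /(allP bs) /= bc; rewrite -leqNgt ltnW.
have ba := allP bs a a_s; rewrite /= in ba.
by rewrite ltn_eqF // ba add1n IHs ?(path_sorted ps).
Qed.

(** This identifies the exponent in [koszul a I] with a position in the increasing list of I, so
    that Laplace signs become Koszul signs. *)
Lemma index_enum_set (n : nat) (I : {set 'I_n}) (a : 'I_n) :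
  a \in I -> index a (enum I) = #|[set b in I | (b < a)%N]|.
Proof.
move=> aI; rewrite -(index_map val_inj) index_sorted_ltn.
- rewrite count_map cardE -size_filter; congr size.
  rewrite /enum_mem -filter_predI; apply: eq_filter => b /=.
  by rewrite !inE andbC.
- rewrite (@subseq_sorted _ _ ltn_trans _ (map val (enum 'I_n))) //.
    apply: map_subseq; rewrite {1}/enum_mem -enumT; exact: filter_subseq.
  by rewrite val_enum_ord iota_ltn_sorted.
- by rewrite mem_map ?mem_enum //; exact: val_inj.
Qed.

Lemma enum_setD1 (T : finType) (I : {set T}) (a : T) :
  enum (I :\ a) = rem a (enum I).
Proof.
rewrite rem_filter ?enum_uniq // /enum_mem -filter_predI.
by apply: eq_filter => b /=; rewrite !inE.
Qed.

Lemma nth_rem (T : eqType) (x0 a : T) (s : seq T) (k : nat) :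
  a \in s -> nth x0 (rem a s) k = nth x0 s (bump (index a s) k).
Proof.
move=> a_s; rewrite remE nth_cat size_take index_mem a_s /bump.
case: ltnP => h; first by rewrite nth_take.
by rewrite nth_drop addSn subnKC.
Qed.

Section SeqMinor.
Variables (R : comNzRingType) (T : eqType) (x0 : T) (B : T -> T -> R).

(** Rows and columns are listed by sequences, so that deleting one is [rem] and a row may occur
    twice. The default [x0] is never reached when both lists have length m. *)
Definition seq_minor m (s t : seq T) : R :=
  \det (\matrix_(k < m, l < m) B (nth x0 s k) (nth x0 t l)).

(** Laplace expansion along the first row labelled a; [uniq t] lets each column be recovered from
    its label. *)
Lemma seq_minor_expand m (s t : seq T) (a : T) :
    a \in s -> size s = m.+1 -> uniq t -> size t = m.+1 ->
  seq_minor m.+1 s t = \sum_(b <- t)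
    (-1) ^+ (index a s + index b t) * B a b * seq_minor m (rem a s) (rem b t).
Proof.
move=> a_s s_size t_uniq t_size.
have ltas : (index a s < m.+1)%N by rewrite -s_size index_mem.
rewrite /seq_minor (expand_det_row _ (Ordinal ltas)) (big_nth x0) t_size.
rewrite big_mkord; apply: eq_bigr => l _.
rewrite mxE /= nth_index // /cofactor index_uniq ?t_size //=.
rewrite mulrCA mulrA; congr (_ * \det _).
apply/matrixP => i j; rewrite !mxE !nth_rem ?mem_nth ?t_size //.
by rewrite index_uniq ?t_size.
Qed.

End SeqMinor.

Section Gram.
Variables (R : realType) (n : nat) (G : 'M[R]_n).
Implicit Types (I J : {set 'I_n}) (a b : 'I_n).

Lemma gram_seq_minor (x0 : 'I_n) I J : #|I| = #|J| ->
  gram G I J = seq_minor x0 (invmx G) #|I| (enum I) (enum J).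
Proof.
move=> IJ; rewrite /gram (introT eqP IJ); congr (\det _); apply/matrixP => k l.
rewrite !mxE (set_nth_default x0) -?cardE -?IJ //.
by rewrite (enum_val_nth x0).
Qed.

Lemma gram_card_neq I J : #|I| != #|J| -> gram G I J = 0.
Proof. by rewrite /gram => /negPf ->. Qed.

(** Laplace expansion along the row of a; the factor [koszul a I] cancels the sign of that row. If
    the cardinalities do not match, both sides vanish. *)
Lemma gram_expand a I J : a \notin I ->
  koszul R a I * (gram G (a |: I) J)%:C%C =
  \sum_(b in J) koszul R b J * (invmx G a b * gram G I (J :\ b))%:C%C.
Proof.
move=> aI.
have [card_eq | card_neq] := eqVneq #|a |: I| #|J|; last first.
  rewrite gram_card_neq // mulr0 big1 // => b bJ.
  rewrite gram_card_neq ?mulr0 //; move: card_neq.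
  by rewrite cardsU1 aI (cardsD1 b J) bJ eqn_add2l.
have I_card : #|J| = #|I|.+1 by rewrite -card_eq cardsU1 aI.
have aaI : a \in enum (a |: I) by rewrite mem_enum setU11.
rewrite (gram_seq_minor a) // card_eq I_card.
rewrite (seq_minor_expand _ _ aaI) ?enum_uniq -?cardE ?card_eq //.
rewrite big_enum /= rmorph_sum mulr_sumr; apply: eq_bigr => b bJ.
rewrite -enum_setD1 (finset.setU1K aI).
rewrite (gram_seq_minor a) -?enum_setD1; last first.
  by apply/eqP; rewrite -eqSS -I_card (cardsD1 b J) bJ.
rewrite !rmorphM /= rmorphXn rmorphN1 !index_enum_set ?setU11 // exprD !mulrA.
congr (_ * _ * _).
rewrite -!/(koszul R _ _) koszulU1 // ltnn expr0 mul1r.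
by rewrite /koszul -expr2 sqrr_sign mul1r.
Qed.

(** For matching cardinalities the sum is the Laplace expansion of a determinant in which the row of
    a occurs twice. *)
Lemma gram_expand_mem a I J : a \in I ->
  \sum_(b in J) koszul R b J * (invmx G a b * gram G I (J :\ b))%:C%C = 0.
Proof.
move=> aI.
have [J_card | card_neq] := eqVneq #|J| #|I|.+1; last first.
  rewrite big1 // => b bJ; rewrite gram_card_neq ?mulr0 //.
  by move: card_neq; rewrite (cardsD1 b J) bJ add1n eqSS eq_sym.
have minor0 : seq_minor a (invmx G) #|I|.+1 (a :: enum I) (enum J) = 0.
  have ltaI : (index a (enum I) < #|I|)%N by rewrite cardE index_mem mem_enum.
  apply: (@determinant_alternate _ _ _ ord0 (lift ord0 (Ordinal ltaI))) => // l.
  by rewrite !mxE /= nth_index ?mem_enum.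
transitivity ((seq_minor a (invmx G) #|I|.+1 (a :: enum I) (enum J))%:C%C);
  last by rewrite minor0.
rewrite (seq_minor_expand _ _ (mem_head a _)) ?enum_uniq /= -?cardE //.
rewrite big_enum /= rmorph_sum; apply: eq_bigr => b bJ.
rewrite eqxx add0n (gram_seq_minor a) ?enum_setD1; last first.
  by apply/eqP; rewrite -eqSS -J_card (cardsD1 b J) bJ.
by rewrite !rmorphM /= rmorphXn rmorphN1 index_enum_set // mulrA.
Qed.

Lemma gram_set0 J : gram G finset.set0 J = (J == finset.set0)%:R.
Proof.
have [-> | J0] := eqVneq.
  have det0 m (A : 'M[R]_m) : m = 0 -> \det A = 1.
    by move=> m0; rewrite m0 in A *; exact: det_mx00.
  by rewrite /gram eqxx det0 ?cards0.
by rewrite gram_card_neq // cards0 eq_sym cards_eq0.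
Qed.


Lemma contr_coef (u : 'rV[R]_n) (y : ext R n) I : contr u y I =
  \sum_(a | a \notin I) (u 0 a)%:C%C * (koszul R a I * y (a |: I)).
Proof.
rewrite contrE sum_ffunE [RHS]big_mkcond /=; apply: eq_bigr => a _.
rewrite !ffunE /=; case: ifP => _; first by rewrite mul1r.
by rewrite !mul0r scaler0.
Qed.

(** The vector [v *m invmx G] is the metric dual of v. In coordinates the adjunction is the Laplace
    expansion of the Gram determinants. *)
Lemma herm_wedge (v : 'rV[R]_n) (x y : ext R n) :
  herm G (wedge v x) y = herm G x (contr (v *m invmx G) y).
Proof.
rewrite /herm.
(* Reindex by inserting a into I, so that x is evaluated at I. *)
transitivity (\sum_(I : {set 'I_n}) \sum_(a | a \notin I)
    \sum_(J : {set 'I_n}) x I * (v 0 a)%:C%C *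
    ((y J)^*)%C * (koszul R a I * (gram G (a |: I) J)%:C%C)).
  transitivity (\sum_(I : {set 'I_n}) \sum_(a in I)
      \sum_(J : {set 'I_n}) x (I :\ a) * (v 0 a)%:C%C *
      ((y J)^*)%C * (koszul R a I * (gram G I J)%:C%C)).
    apply: eq_bigr => I _; rewrite exchange_big; apply: eq_bigr => J _ /=.
    rewrite lfunE ffunE !mulr_suml; apply: eq_bigr => a aI.
    by rewrite -/(koszul R a I); ring.
  rewrite (exchange_big_dep predT) //= [RHS](exchange_big_dep predT) //=.
  apply: eq_bigr => a _.
  rewrite (reindex_onto (fun I : {set 'I_n} => a |: I)
    (fun I : {set 'I_n} => I :\ a)) /=; last first.
    by move=> I aI; rewrite finset.setD1K.
  rewrite (eq_bigl (fun I : {set 'I_n} => a \notin I)) => [|I]; last first.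
    rewrite setU11 /=; apply/eqP/idP => [<- | /finset.setU1K //].
    by rewrite finset.setD11.
  apply: eq_bigr => I aI; rewrite finset.setU1K //; apply: eq_bigr => J _.
  by rewrite koszulU1 // ltnn expr0 mul1r.
apply: eq_bigr => I _.
(* Expand along the row of a. The terms with a in I may be added, as they vanish by
   [gram_expand_mem]. *)
transitivity (\sum_a \sum_(J : {set 'I_n}) \sum_(b in J)
   x I * (v 0 a)%:C%C * ((y J)^*)%C *
   (koszul R b J * (invmx G a b * gram G I (J :\ b))%:C%C)).
  rewrite big_mkcond; apply: eq_bigr => a _.
  case: ifPn => [|/negPn] aI; last first.
    rewrite big1 // => J _; rewrite -mulr_sumr.
    by rewrite gram_expand_mem ?mulr0.
  by apply: eq_bigr => J _; rewrite gram_expand // mulr_sumr.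
rewrite exchange_big /=.
(* Summing over a assembles the coordinates of the dual vector. *)
transitivity (\sum_(J : {set 'I_n}) \sum_(b in J)
   x I * ((v *m invmx G) 0 b)%:C%C * ((y J)^*)%C *
   (koszul R b J * (gram G I (J :\ b))%:C%C)).
  apply: eq_bigr => J _; rewrite exchange_big; apply: eq_bigr => b _ /=.
  rewrite mxE rmorph_sum mulr_sumr !mulr_suml; apply: eq_bigr => a _.
  by rewrite !rmorphM /=; ring.
(* Reindex by inserting b into J, which produces the coefficients of the contraction of y. *)
transitivity (\sum_(J : {set 'I_n}) \sum_(b | b \notin J)
   x I * ((v *m invmx G) 0 b)%:C%C * ((y (b |: J))^*)%C *
   (koszul R b J * (gram G I J)%:C%C)).
  rewrite (exchange_big_dep predT) //= [RHS](exchange_big_dep predT) //=.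
  apply: eq_bigr => b _.
  rewrite (reindex_onto (fun J : {set 'I_n} => b |: J)
    (fun J : {set 'I_n} => J :\ b)) /=; last first.
    by move=> J bJ; rewrite finset.setD1K.
  rewrite (eq_bigl (fun J : {set 'I_n} => b \notin J)) => [|J]; last first.
    rewrite setU11 /=; apply/eqP/idP => [<- | /finset.setU1K //].
    by rewrite finset.setD11.
  apply: eq_bigr => J bJ; rewrite finset.setU1K //.
  by rewrite koszulU1 // ltnn expr0 mul1r.
apply: eq_bigr => J _.
rewrite contr_coef rmorph_sum mulr_sumr mulr_suml; apply: eq_bigr => b _.
rewrite !rmorphM /=.
have -> : ((v *m invmx G) 0 b -i* 0)%C = ((v *m invmx G) 0 b)%:C%C.
  by rewrite oppr0.
have -> : ((koszul R b J)^*)%C = koszul R b J by rewrite rmorphXn rmorphN1.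
by ring.
Qed.


End Gram.

(** * Adjoints *)

Section Adjoint.
Variables (R : realType) (n : nat) (G : 'M[R]_n).
Implicit Types (x y z : ext R n) (f : 'End(ext R n)).

Lemma hermDl x y z : herm G (x + y) z = herm G x z + herm G y z.
Proof.
rewrite /herm -big_split; apply: eq_bigr => I _; rewrite -big_split.
by apply: eq_bigr => J _; rewrite ffunE /= !mulrDl.
Qed.

Lemma hermDr x y z : herm G x (y + z) = herm G x y + herm G x z.
Proof.
rewrite /herm -big_split; apply: eq_bigr => I _; rewrite -big_split.
by apply: eq_bigr => J _; rewrite ffunE rmorphD mulrDr mulrDl.
Qed.

Lemma hermNr x y : herm G x (- y) = - herm G x y.
Proof.
rewrite /herm -sumrN; apply: eq_bigr => I _; rewrite -sumrN.
by apply: eq_bigr => J _; rewrite ffunE rmorphN mulrN mulNr.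
Qed.

Hypothesis G_unit : G \in unitmx.

(* Contractions are adjoint to wedge products, so contracting z repeatedly moves
   each of its coefficients to the empty set, where [gram] is trivial. *)
Lemma herm_nondegenerate z : (forall x, herm G x z = 0) -> z = 0.
Proof.
move=> z0; apply/ffunP => I; rewrite [RHS]ffunE.
have [k] := ubnP #|I|; elim: k => // k IHk in z z0 I *; rewrite ltnS => Ik.
have [-> | [a aI]] := set_0Vmem I.
  have := z0 [ffun J : {set 'I_n} => (J == finset.set0)%:R].
  rewrite /herm (bigD1 finset.set0) //= [X in _ + X]big1 ?addr0 => [|J J0].
    rewrite (bigD1 finset.set0) //= [X in _ + X]big1 ?addr0 => [|J J0].
      rewrite ffunE gram_set0 eqxx mul1r mulr1 => /eqP.
      by rewrite fmorph_eq0 => /eqP.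
    by rewrite gram_set0 (negPf J0) mulr0.
  by rewrite big1 // => L _; rewrite ffunE (negPf J0) !mul0r.
have /IHk/(_ (I :\ a)) : forall x, herm G x (contr (delta_mx 0 a) z) = 0.
  move=> x; rewrite -[delta_mx 0 a](mulmxK G_unit) -herm_wedge; exact: z0.
rewrite (cardsD1 a I) aI in Ik; move/(_ Ik).
rewrite contr_coef (bigD1 a) ?setD11 //= big1 => [|b /andP[_ ba]]; last first.
  by rewrite mxE eqxx (negPf ba) mul0r.
rewrite mxE !eqxx mul1r addr0 finset.setD1K // => /eqP.
by rewrite mulf_eq0 signr_eq0 => /eqP.
Qed.

(** [adj] picks some adjoint, or 0 if there is none; nondegeneracy makes an adjoint unique, so
    exhibiting one determines the choice. *)
Lemma adj_eq f f' :
  (forall x y, herm G (f x) y = herm G x (f' y)) -> adj G f = f'.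
Proof.
move=> ff'; apply: xget_unique => // h fh; apply/lfunP => y.
apply/eqP; rewrite -subr_eq0; apply/eqP; apply: herm_nondegenerate => x.
by rewrite hermDr hermNr -fh -ff' subrr.
Qed.

End Adjoint.

(** * Canonical anticommutation relations *)

Definition car_system (K : comNzRingType) (A : algType K) (T : eqType)
    (a b : T -> A) : Prop :=
  [/\ forall m n, a m * a n = - (a n * a m),
      forall m n, b m * b n = - (b n * b m) &
      forall m n, b m * a n = (m == n)%:R - a n * b m].

(** Moving creation operators to the left, both products acquire the same quartic term, which
    cancels; the contractions left over are those of matrix units. *)
Lemma car_bracket (K : comNzRingType) (A : algType K) (T : eqType)
    (a b : T -> A) : car_system a b -> forall m n p q,
  a m * b n * (a p * b q) - a p * b q * (a m * b n) =
  (n == p)%:R *: (a m * b q) - (m == q)%:R *: (a p * b n).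
Proof.
case=> aC bC baC m n p q.
have abab k l i j : a k * b l * (a i * b j) =
    (l == i)%:R *: (a k * b j) - a k * a i * b l * b j.
  rewrite mulrA -(mulrA (a k)) baC mulrBr mulrBl !mulrA; congr (_ + _).
  by case: eqP => _; rewrite ?mulr1 ?mulr0 ?mul0r ?scale1r ?scale0r.
have -> : a p * b q * (a m * b n) =
    (q == m)%:R *: (a p * b n) - a m * a p * b n * b q.
  by rewrite abab (aC p) mulNr mulNr -(mulrA _ (b q)) (bC q) mulrN !mulrA opprK.
by rewrite abab opprB addrA subrK (eq_sym q).
Qed.

(** * The representation of gl(N, R) by quadratic expressions *)

Section RealSpan.
Variables (R : realType) (A : algType R[i]).
Implicit Types (f h : A).

Definition real_lie_closed (P : A -> Prop) : Prop :=
  [/\ P 0,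
      forall f h, P f -> P h -> P (f + h),
      forall (r : R) f, P f -> P (r%:C%C *: f) &
      forall f h, P f -> P h -> P (f * h - h * f)].

Variables (N : nat) (a b : 'I_N -> A).
Hypothesis ab_car : car_system a b.

(** The second quantization of the matrix X. *)
Definition gl_rep (X : 'M[R]_N) : A :=
  \sum_m \sum_n (X m n)%:C%C *: (a m * b n).

Lemma gl_repD X Y : gl_rep (X + Y) = gl_rep X + gl_rep Y.
Proof.
rewrite /gl_rep -big_split; apply: eq_bigr => m _; rewrite -big_split.
by apply: eq_bigr => n _; rewrite mxE rmorphD scalerDl.
Qed.

Lemma gl_repZ r X : gl_rep (r *: X) = r%:C%C *: gl_rep X.
Proof.
rewrite /gl_rep scaler_sumr; apply: eq_bigr => m _; rewrite scaler_sumr.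
by apply: eq_bigr => n _; rewrite mxE rmorphM scalerA.
Qed.

Lemma gl_rep_delta m n : gl_rep (delta_mx m n) = a m * b n.
Proof.
rewrite /gl_rep (bigD1 m) //= [X in _ + X]big1 ?addr0 => [|i im]; last first.
  by rewrite big1 // => j _; rewrite mxE (negPf im) scale0r.
rewrite (bigD1 n) //= big1 ?addr0 => [|j jn].
  by rewrite mxE !eqxx scale1r.
by rewrite mxE (negPf jn) andbF scale0r.
Qed.

Lemma gl_rep_bracket X Y :
  gl_rep (X *m Y - Y *m X) = gl_rep X * gl_rep Y - gl_rep Y * gl_rep X.
Proof.
have mulE X' Y' : gl_rep X' * gl_rep Y' = \sum_m \sum_n \sum_p \sum_q
    ((X' m n)%:C%C * (Y' p q)%:C%C) *: (a m * b n * (a p * b q)).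
  rewrite /gl_rep mulr_suml; apply: eq_bigr => m _; rewrite mulr_suml.
  apply: eq_bigr => n _; rewrite mulr_sumr; apply: eq_bigr => p _.
  rewrite mulr_sumr; apply: eq_bigr => q _.
  by rewrite -scalerAl -scalerAr scalerA.
have prodE X' Y' : gl_rep (X' *m Y') = \sum_m \sum_n \sum_p \sum_q
    ((X' m n)%:C%C * (Y' p q)%:C%C) *: ((n == p)%:R *: (a m * b q)).
  apply: eq_bigr => m _.
  transitivity (\sum_q \sum_n
      ((X' m n)%:C%C * (Y' n q)%:C%C) *: (a m * b q)).
    apply: eq_bigr => q _; rewrite mxE rmorph_sum scaler_suml.
    by apply: eq_bigr => n _; rewrite rmorphM.
  rewrite exchange_big; apply: eq_bigr => n _ /=.
  rewrite [RHS](bigD1 n) //= [X in _ = _ + X]big1 ?addr0 => [|p pn].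
    by apply: eq_bigr => q _; rewrite eqxx scale1r.
  by rewrite big1 // => q _; rewrite eq_sym (negPf pn) scale0r scaler0.
(* Exchanging the index pairs (m, n) and (p, q) in the subtracted sums lets [car_bracket] be applied
   term by term. *)
have swap (F : 'I_N -> 'I_N -> 'I_N -> 'I_N -> A) :
    \sum_m \sum_n \sum_p \sum_q F m n p q =
    \sum_m \sum_n \sum_p \sum_q F p q m n.
  have pairE F' : \sum_m \sum_n \sum_p \sum_q F' m n p q =
      \sum_(i : 'I_N * 'I_N) \sum_(j : 'I_N * 'I_N) F' i.1 i.2 j.1 j.2 :> A.
    rewrite pair_bigA; apply: eq_bigr => i _.
    by rewrite pair_bigA.
  by rewrite !pairE exchange_big.
rewrite gl_repD -scaleN1r gl_repZ rmorphN1 scaleN1r !prodE !mulE.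
rewrite [X in _ - X]swap [X in _ = _ - X]swap -!sumrB.
apply: eq_bigr => m _; rewrite -!sumrB; apply: eq_bigr => n _.
rewrite -!sumrB; apply: eq_bigr => p _; rewrite -!sumrB; apply: eq_bigr => q _.
by rewrite !(mulrC (Y p q)%:C%C) -!scalerBr car_bracket // (eq_sym q).
Qed.

(** The commutator with [a p] extracts column p as a combination of the [a m]; the anticommutator of
    that with [b q] is the entry (q, p) times 1. *)
Lemma gl_rep_inj : injective gl_rep.
Proof.
case: (ab_car) => aC bC baC.
have ker0 X : gl_rep X = 0 -> X = 0.
  move=> X0; apply/matrixP => q p; rewrite mxE.
  have col0 : \sum_m (X m p)%:C%C *: a m = 0.
    transitivity (gl_rep X * a p - a p * gl_rep X); last first.
      by rewrite X0 mul0r mulr0 subrr.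
    rewrite /gl_rep mulr_suml mulr_sumr -sumrB; apply: eq_bigr => m _.
    rewrite mulr_suml mulr_sumr -sumrB (bigD1 p) //= big1 => [|n np].
      rewrite addr0 -scalerAl -scalerAr -scalerBr; congr (_ *: _).
      by rewrite -mulrA baC eqxx mulrBr mulr1 !mulrA (aC p) mulNr opprK subrK.
    rewrite -scalerAl -scalerAr -scalerBr -mulrA baC (negPf np) mulrBr mulr0.
    by rewrite !mulrA (aC p) mulNr opprK sub0r addNr scaler0.
  have : (X q p)%:C%C *: (1 : A) = 0.
    transitivity (b q * (\sum_m (X m p)%:C%C *: a m)
                  + (\sum_m (X m p)%:C%C *: a m) * b q).
      rewrite mulr_suml mulr_sumr -big_split (bigD1 q) //= big1 => [|m mq].
        by rewrite addr0 -scalerAl -scalerAr -scalerDr baC eqxx subrK.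
      rewrite -scalerAl -scalerAr -scalerDr baC eq_sym (negPf mq) sub0r addNr.
      by rewrite scaler0.
    by rewrite col0 mulr0 mul0r addr0.
  move/eqP; rewrite scaler_eq0 oner_eq0 orbF fmorph_eq0 => /eqP //.
move=> X Y XY; apply/eqP; rewrite -subr_eq0; apply/eqP/ker0.
by rewrite gl_repD -scaleN1r gl_repZ XY rmorphN1 scaleN1r subrr.
Qed.

Variable P : A -> Prop.
Hypothesis P_closed : real_lie_closed P.

Lemma real_lie_closedB f h : P f -> P h -> P (f - h).
Proof.
case: P_closed => _ PD PZ _ Pf Ph; apply: PD => //.
by rewrite -scaleN1r -[-1](rmorphN1 (real_complex R)); apply: PZ.
Qed.

Lemma real_lie_closed_sum (I : Type) (r : seq I) (Q : pred I) (F : I -> A) :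
  (forall i, Q i -> P (F i)) -> P (\sum_(i <- r | Q i) F i).
Proof. by move=> PF; case: P_closed => P0 PD _ _; exact: big_ind. Qed.

(** Differences of diagonal units are brackets: [a_m b_m0, a_m0 b_m] = a_m b_m - a_m0 b_m0. *)
Lemma gl_rep_traceless (m0 : 'I_N) X :
    (forall m n, m != n -> P (a m * b n)) -> \tr X = 0 -> P (gl_rep X).
Proof.
case: (P_closed) => _ PD PZ PB Pab tr0.
(* As the trace is zero, each diagonal unit may be replaced by its difference with the one at
   [m0]. *)
have -> : gl_rep X = \sum_m \sum_n (X m n)%:C%C *:
    (a m * b n - (m == n)%:R *: (a m0 * b m0)).
  transitivity (gl_rep X - (\tr X)%:C%C *: (a m0 * b m0)).
    by rewrite tr0 scale0r subr0.
  rewrite /gl_rep rmorph_sum scaler_suml -sumrB; apply: eq_bigr => m _.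
  under [in RHS]eq_bigr do rewrite scalerBr.
  rewrite sumrB; congr (_ + _).
  rewrite (bigD1 m) //= eqxx scale1r big1 ?addr0 // => n nm.
  by rewrite eq_sym (negPf nm) scale0r scaler0.
apply: real_lie_closed_sum => m _; apply: real_lie_closed_sum => n _.
apply: PZ; have [<- | mn] := eqVneq m n; last first.
  by rewrite scale0r subr0; exact: Pab.
rewrite scale1r; have [<- | mm0] := eqVneq m m0.
  by rewrite subrr; case: P_closed.
have mm0' : m0 != m by rewrite eq_sym.
have := PB _ _ (Pab _ _ mm0) (Pab _ _ mm0').
by rewrite car_bracket // !eqxx !scale1r.
Qed.

End RealSpan.

(** * Generation of the off-diagonal matrix units *)

Section Generation.
Variables (R : realType) (A : algType R[i]) (J : finType).
Variables (a b : bool * J -> A).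
Hypothesis ab_car : car_system a b.
Hypothesis J_card : (2 < #|J|)%N.
Variable P : A -> Prop.
Hypothesis P_closed : real_lie_closed P.

Local Notation lo j := (false, j).
Local Notation hi j := (true, j).
Local Notation M m n := (a m * b n).

Hypothesis P_L : forall j k, j != k -> P (M (lo j) (hi k) - M (lo k) (hi j)).
Hypothesis P_Lambda :
  forall j k, j != k -> P (M (hi k) (lo j) - M (hi j) (lo k)).
Hypothesis P_V : forall j, P (M (lo j) (hi j)).
Hypothesis P_A : forall j, P (M (hi j) (lo j)).

Let bracketBr (x y z : A) :
  x * (y - z) - (y - z) * x = (x * y - y * x) - (x * z - z * x).
Proof. by rewrite mulrBr mulrBl !opprB addrACA [RHS]addrACA [- _ + _]addrC. Qed.

Let bracketBl (x y z : A) :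
  (x - y) * z - z * (x - y) = (x * z - z * x) - (y * z - z * y).
Proof. by rewrite mulrBr mulrBl !opprB addrACA [RHS]addrACA [- _ + _]addrC. Qed.

(** Minus the bracket of [M (lo j) (hi j)] with the Lambda generator for j, k: each term of the
    latter yields one unit, with equal signs. *)
Let bracket_sum j k : j != k -> P (M (lo j) (lo k) + M (hi k) (hi j)).
Proof.
move=> jk; case: (P_closed) => _ _ PZ PB.
have := PZ (-1) _ (PB _ _ (P_V j) (P_Lambda jk)).
rewrite bracketBr !car_bracket // !xpair_eqE /= !eqxx (negPf jk) /=.
rewrite !(scale0r, scale1r) rmorphN1 scaleN1r.
by rewrite !(oppr0, addr0, add0r, subr0, sub0r, opprD, opprK) addrC.
Qed.

(** Minus the bracket of the L generator for j, l with the Lambda generator for l, k: only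
    contractions over l survive, now with opposite signs. *)
Let bracket_diff j k : j != k -> P (M (lo j) (lo k) - M (hi k) (hi j)).
Proof.
move=> jk; case: (P_closed) => _ _ PZ PB.
(* A third index exists because J has more than two elements. *)
have [l /andP[lj lk]] : exists l, (l != j) && (l != k).
  have : (0 < #|~: [set j; k]|)%N.
    by rewrite -(ltn_add2l #|[set j; k]|) cardsC addn0 cards2 jk.
  by case/card_gt0P => l; rewrite !inE negb_or; exists l.
have jl : j != l by rewrite eq_sym.
have := PZ (-1) _ (PB _ _ (P_L jl) (P_Lambda lk)).
rewrite bracketBr !bracketBl !car_bracket // !xpair_eqE /= !eqxx /=.
have kj : k != j by rewrite eq_sym.
have kl : k != l by rewrite eq_sym.
rewrite ?(negPf jk) ?(negPf kj) ?(negPf jl) ?(negPf lj) ?(negPf lk) ?(negPf kl).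
rewrite !(scale0r, scale1r) rmorphN1 scaleN1r.
by rewrite !(oppr0, addr0, add0r, subr0, sub0r, opprD, opprK) addrC.
Qed.

Let P_half (x : A) : P (x + x) -> P x.
Proof.
case: P_closed => _ _ PZ _ /(PZ 2^-1).
rewrite fmorphV rmorph_nat -mulr2n -scalerMnr scalerMnl -mulr_natr.
by rewrite mulVf ?scale1r ?pnatr_eq0.
Qed.

Let P_lolo j k : j != k -> P (M (lo j) (lo k)).
Proof.
move=> jk; apply: P_half; case: (P_closed) => _ PD _ _.
have := PD _ _ (bracket_sum jk) (bracket_diff jk).
by rewrite addrACA subrr addr0.
Qed.

Let P_hihi j k : j != k -> P (M (hi k) (hi j)).
Proof.
move=> jk; have := real_lie_closedB P_closed (bracket_sum jk) (P_lolo jk).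
by rewrite addrC addKr.
Qed.

(** The mixed units with j = k are hypotheses; the others are brackets such as
    [M (hi j) (hi k), M (hi k) (lo k)] = M (hi j) (lo k). *)
Lemma generated_off_diagonal m n : m != n -> P (M m n).
Proof.
case: (P_closed) => _ _ _ PB; case: m n => [[] j] [[] k] mn.
- by apply: P_hihi; move: mn; rewrite xpair_eqE /= eq_sym.
- have [<- // | jk] := eqVneq j k.
  have kj : k != j by rewrite eq_sym.
  have := PB _ _ (P_hihi kj) (P_A k).
  by rewrite car_bracket // !eqxx !xpair_eqE scale1r scale0r subr0.
- have [<- // | jk] := eqVneq j k.
  have := PB _ _ (P_lolo jk) (P_V k).
  by rewrite car_bracket // !eqxx !xpair_eqE scale1r scale0r subr0.
- by apply: P_lolo; move: mn; rewrite xpair_eqE.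
Qed.

End Generation.

(** * Creation and annihilation operators from the coframe *)

Section Fermions.
Variables (R : realType) (A : algType R[i]) (J : eqType).

(** The anticommutator, symmetric and bilinear, so that the relations can be checked on the E and
    C. *)
Let ac (x y : A) := x * y + y * x.

Let acC x y : ac x y = ac y x. Proof. by rewrite /ac addrC. Qed.

Let acl (c : R[i]) x y z : ac (x + c *: y) z = ac x z + c *: ac y z.
Proof. by rewrite /ac mulrDl mulrDr addrACA scalerDr scalerAl scalerAr. Qed.

Let acr (c : R[i]) x y z : ac z (x + c *: y) = ac z x + c *: ac z y.
Proof. by rewrite acC acl !(acC _ z). Qed.

Let acZ (c d : R[i]) x y : ac (c *: x) (d *: y) = (c * d) *: ac x y.
Proof.
by rewrite /ac -!scalerAl -!scalerAr !scalerA (mulrC d) scalerDr.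
Qed.

Variables (E C : 'I_2 -> J -> A).
Hypothesis E_anticomm : forall i j i' j', E i j * E i' j' = - (E i' j' * E i j).
Hypothesis C_anticomm : forall i j i' j', C i j * C i' j' = - (C i' j' * C i j).
Hypothesis CE_anticomm : forall i j i' j',
  C i j * E i' j' = ((i == i') && (j == j'))%:R - E i' j' * C i j.

(** e_j at (false, j) and f*_j at (true, j), where [ord0] and [ord_max] stand for i = 1, 2. *)
Definition fermi_create (t : bool * J) : A :=
  let X := if t.1 then C else E in X ord0 t.2 + ('i)%C *: X ord_max t.2.

(** e*_j at (false, j) and f_j at (true, j); the factor 1/2 is put here in both cases to normalize
    the anticommutators. *)
Definition fermi_annihilate (t : bool * J) : A :=
  let X := if t.1 then E else C in
  2^-1 *: (X ord0 t.2 + (- ('i)%C) *: X ord_max t.2).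

Let acEE i j i' j' : ac (E i j) (E i' j') = 0.
Proof. by rewrite /ac E_anticomm addNr. Qed.

Let acCC i j i' j' : ac (C i j) (C i' j') = 0.
Proof. by rewrite /ac C_anticomm addNr. Qed.

Let acCE i j i' j' : ac (C i j) (E i' j') = ((i == i') && (j == j'))%:R.
Proof. by rewrite /ac CE_anticomm subrK. Qed.

Let acEC i j i' j' : ac (E i j) (C i' j') = ((i == i') && (j == j'))%:R.
Proof. by rewrite acC acCE (eq_sym i) (eq_sym j). Qed.

Let ii : ('i * 'i)%C = -1 :> R[i]. Proof. by rewrite -expr2 sqr_i. Qed.

Let half_double (x : A) : 2^-1 *: (x + x) = x :> A.
Proof.
by rewrite -mulr2n -scalerMnr scalerMnl -mulr_natr mulVf ?pnatr_eq0 // scale1r.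
Qed.

(** Two creators, or two annihilators, meet with coefficient 1 + i^2 = 0; an annihilator meets its
    creator with (1 - i^2)/2 = 1. *)
Lemma fermi_car : car_system fermi_create fermi_annihilate.
Proof.
split=> m n.
- apply/eqP; rewrite -addr_eq0; apply/eqP; rewrite -/(ac _ _) /fermi_create.
  case: m n => [[] j] [[] k] /=; rewrite !acl !acr ?(acEE, acCC, acCE, acEC) /=;
    by rewrite ?(mulr0n, scaler0, addr0, add0r) // scalerA ii scaleN1r addrN.
- apply/eqP; rewrite -addr_eq0; apply/eqP; rewrite -/(ac _ _) /fermi_annihilate.
  case: m n => [[] j] [[] k] /=;
    rewrite acZ !acl !acr ?(acEE, acCC, acCE, acEC) /=;
    by rewrite ?(mulr0n, scaler0, addr0, add0r) //
      scalerA mulrNN ii scaleN1r addrN scaler0.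
- apply/eqP; rewrite eq_sym subr_eq eq_sym; apply/eqP.
  rewrite -/(ac _ _) /fermi_create /fermi_annihilate.
  rewrite -[X in ac _ X]scale1r acZ mulr1.
  case: m n => [[] j] [[] k] /=; rewrite !acl !acr ?(acEE, acCC, acCE, acEC) /=;
    rewrite ?xpair_eqE ?(mulr0n, scaler0, addr0, add0r) //
      scalerA mulNr ii opprK;
    by rewrite scale1r half_double.
Qed.

Let combE (x y x' y' : A) :
  (x + ('i)%C *: y) * (2^-1 *: (x' + (- ('i)%C) *: y')) =
  2^-1 *: (x * x' + y * y' + ('i)%C *: (y * x' - x * y')).
Proof.
rewrite -scalerAr mulrDl !mulrDr -!scalerAl -!scalerAr scalerA mulrN ii opprK.
by rewrite scale1r scalerBr scaleNr addrACA (addrC (- _)) addrA addrACA addrA.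
Qed.

(** Under the exchange of (x, y) with (x', y') the part xx' + yy' of [combE] changes sign, while the
    part with factor i is unchanged and cancels. *)
Let comb_skewE (x y x' y' : A) :
  x' * x = - (x * x') -> y' * y = - (y * y') ->
  y' * x = - (x * y') -> x' * y = - (y * x') ->
  (x + ('i)%C *: y) * (2^-1 *: (x' + (- ('i)%C) *: y')) -
  (x' + ('i)%C *: y') * (2^-1 *: (x + (- ('i)%C) *: y)) = x * x' + y * y'.
Proof.
move=> xx yy yx xy; rewrite !combE xx yy yx xy -scalerBr -[RHS]half_double.
apply: (congr1 ( *:%R 2^-1)); rewrite opprK (addrC (- (x * y'))).
by rewrite -(opprD (x * x')) (opprD (- _)) opprK addrACA subrr addr0.
Qed.

Let comb_selfE (x y : A) : x * x = - (x * x) -> y * y = - (y * y) ->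
    y * x = - (x * y) ->
  (x + ('i)%C *: y) * (2^-1 *: (x + (- ('i)%C) *: y)) = ('i)%C *: (y * x).
Proof.
have sqr0 (z : A) : z = - z -> z = 0.
  by move=> zN; rewrite -[z]half_double {2}zN subrr scaler0.
move=> /sqr0 xx /sqr0 yy yx; rewrite combE xx yy addr0 add0r.
have -> : x * y = - (y * x) by rewrite yx opprK.
by rewrite opprK scalerA mulrC -scalerA half_double.
Qed.

Let sum_ord2 (F : 'I_2 -> A) : \sum_i F i = F ord0 + F ord_max.
Proof. by rewrite big_ord_recl big_ord1; congr (_ + F _); apply: val_inj. Qed.

Lemma fermi_L j k :
  fermi_create (false, j) * fermi_annihilate (true, k) -
  fermi_create (false, k) * fermi_annihilate (true, j) = \sum_i E i j * E i k.
Proof. by rewrite comb_skewE // sum_ord2. Qed.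

Lemma fermi_Lambda j k :
  fermi_create (true, j) * fermi_annihilate (false, k) -
  fermi_create (true, k) * fermi_annihilate (false, j) = \sum_i C i j * C i k.
Proof. by rewrite comb_skewE // sum_ord2. Qed.

Lemma fermi_V j : fermi_create (false, j) * fermi_annihilate (true, j) =
  - (('i)%C *: (E ord0 j * E ord_max j)).
Proof. by rewrite comb_selfE // E_anticomm scalerN. Qed.

Lemma fermi_A j : fermi_create (true, j) * fermi_annihilate (false, j) =
  ('i)%C *: (C ord_max j * C ord0 j).
Proof. by rewrite comb_selfE. Qed.

End Fermions.

(** * The generated Lie algebra as the image of sl(2s+2, R) *)

Section SlGenerated.
Variables (R : realType) (A : algType R[i]) (s : nat).
Variables (E C : 'I_2 -> 'I_s.+1 -> A).
Hypothesis s_ge2 : (2 <= s)%N.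
Hypothesis E_anticomm : forall i j i' j', E i j * E i' j' = - (E i' j' * E i j).
Hypothesis C_anticomm : forall i j i' j', C i j * C i' j' = - (C i' j' * C i j).
Hypothesis CE_anticomm : forall i j i' j',
  C i j * E i' j' = ((i == i') && (j == j'))%:R - E i' j' * C i j.

(** The adjoints are already written through the C, hence with the factors in reverse order. *)
Definition sl_generator (f : A) : Prop :=
  (exists j k, j != k /\
     (f = \sum_i E i j * E i k \/ f = \sum_i C i k * C i j)) \/
  (exists j, f = ('i)%C *: (E ord0 j * E ord_max j) \/
             f = ('i)%C *: (C ord_max j * C ord0 j)).

Let card_index : (2 * s + 2)%N = #|{: bool * 'I_s.+1}|.
Proof. by rewrite card_prod card_bool card_ord mulnS addnC. Qed.

(** Matrices are indexed by ordinals, so the 2(s+1) labels in [bool * 'I_s.+1] are numbered by their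
    enumeration. *)
Let index_of (m : 'I_(2 * s + 2)) : bool * 'I_s.+1 :=
  enum_val (cast_ord card_index m).

Let index_to (t : bool * 'I_s.+1) : 'I_(2 * s + 2) :=
  cast_ord (esym card_index) (enum_rank t).

Let index_toK : cancel index_to index_of.
Proof. by move=> t; rewrite /index_of cast_ordKV enum_rankK. Qed.

Let index_of_inj : injective index_of.
Proof. by move=> m n /enum_val_inj /cast_ord_inj. Qed.

Let a m := fermi_create E C (index_of m).
Let b m := fermi_annihilate E C (index_of m).

Let ab_car : car_system a b.
Proof.
have [aC bC baC] := fermi_car E_anticomm C_anticomm CE_anticomm.
split=> m n; [exact: aC | exact: bC | rewrite -(inj_eq index_of_inj)].
exact: baC.
Qed.

Let phi := gl_rep a b.

Lemma sl_rep_image_closed :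
  real_lie_closed (fun f => exists2 X, \tr X = 0 & phi X = f).
Proof.
split.
- by exists 0; [exact: mxtrace0 | rewrite -(scale0r 0) /phi gl_repZ scale0r].
- move=> _ _ [X X0 <-] [Y Y0 <-]; exists (X + Y); last exact: gl_repD.
  by rewrite mxtraceD X0 Y0 addr0.
- move=> r _ [X X0 <-]; exists (r *: X); last exact: gl_repZ.
  by rewrite mxtraceZ X0 mulr0.
- move=> _ _ [X X0 <-] [Y Y0 <-]; exists (X *m Y - Y *m X).
    by rewrite raddfB /= mxtrace_mulC subrr.
  exact: gl_rep_bracket.
Qed.

(** Up to sign, each generator is a unit a_t b_u with t != u or a difference of two such units, and
    off-diagonal matrix units have trace zero. *)
Lemma sl_rep_image_generator f : sl_generator f ->
  exists2 X, \tr X = 0 & phi X = f.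
Proof.
have [_ PD PZ _] := sl_rep_image_closed.
have unit t u : t != u -> exists2 X, \tr X = 0 &
    phi X = fermi_create E C t * fermi_annihilate E C u.
  move=> tu; exists (delta_mx (index_to t) (index_to u)).
    rewrite /mxtrace big1 // => m _; rewrite mxE.
    case: eqP => // ->; case: eqP => // /(can_inj index_toK) /eqP.
    by rewrite (negPf tu).
  by rewrite /phi gl_rep_delta /a /b !index_toK.
case=> [[j [k [_ [] ->]]] | [j [] ->]].
- rewrite -(fermi_L C E_anticomm).
  by apply: (real_lie_closedB sl_rep_image_closed); exact: unit.
- rewrite -(fermi_Lambda E C_anticomm).
  by apply: (real_lie_closedB sl_rep_image_closed); exact: unit.
- have := PZ (-1) _ (unit (false, j) (true, j) isT).
  by rewrite (fermi_V C E_anticomm) rmorphN1 scaleN1r opprK.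
- by rewrite -(fermi_A E C_anticomm); exact: unit.
Qed.

Lemma sl_rep_generated (P : A -> Prop) : real_lie_closed P ->
  (forall f, sl_generator f -> P f) -> forall X, \tr X = 0 -> P (phi X).
Proof.
move=> P_closed genP X X0; have [_ _ PZ _] := P_closed.
apply: (gl_rep_traceless ab_car P_closed (index_to (false, ord0))) => // m n mn.
apply: (generated_off_diagonal (J := 'I_s.+1)
  (fermi_car E_anticomm C_anticomm CE_anticomm)) => //.
- by rewrite card_ord.
- move=> j k jk; rewrite fermi_L //; apply: genP; left; exists j, k; split=> //.
  by left.
- move=> j k jk; rewrite fermi_Lambda //; apply: genP; left; exists j, k.
  by split=> //; right.
- move=> j; rewrite fermi_V // -scaleN1r -[-1](rmorphN1 (real_complex R)).
  by apply: PZ; apply: genP; right; exists j; left.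
- by move=> j; rewrite fermi_A //; apply: genP; right; exists j; right.
- by rewrite (inj_eq index_of_inj).
Qed.

(** The hypotheses characterize S as the smallest real Lie subalgebra containing the generators; the
    two preceding lemmas give the two inclusions. *)
Lemma sl_rep_exists (S : A -> Prop) :
    real_lie_closed S -> (forall f, sl_generator f -> S f) ->
    (forall P : A -> Prop, real_lie_closed P ->
       (forall f, sl_generator f -> P f) -> forall f, S f -> P f) ->
  exists psi : 'M[R]_(2 * s + 2) -> A,
    [/\ injective psi,
        forall f, S f <-> exists2 X, \tr X = 0 & psi X = f,
        {morph psi : X Y / X + Y},
        forall r X, psi (r *: X) = r%:C%C *: psi X &
        forall X Y, psi (X *m Y - Y *m X) = psi X * psi Y - psi Y * psi X].
Proof.
move=> S_closed S_gen S_min; exists phi; split.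
- exact: gl_rep_inj ab_car.
- move=> f; split; last by case=> X X0 <-; exact: sl_rep_generated.
  exact: S_min sl_rep_image_closed sl_rep_image_generator f.
- exact: gl_repD.
- exact: gl_repZ.
- exact: gl_rep_bracket ab_car.
Qed.

End SlGenerated.

(** * The endomorphisms of the exterior algebra under composition *)

Section EndAlgebra.
Variables (R : realType) (n : nat).

Fact ext_id_neq0 : \1%VF != 0 :> 'End(ext R n).
Proof.
apply/eqP => /lfunP/(_ [ffun=> 1]); rewrite id_lfunE zero_lfunE.
by move=> /ffunP/(_ finset.set0)/eqP; rewrite !ffunE oner_eq0.
Qed.

(* MathComp has no canonical ring structure on ['End(_)]; here the product is
   [\o], whereas that of falgebra is composition in the opposite order. *)
Definition ext_end_nzRing : nzRingType :=
  HB.pack 'End(ext R n)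
    (GRing.Zmodule_isNzRing.Build 'End(ext R n) (@comp_lfunA _ _ _ _ _)
       (@comp_lfun1l _ _ _) (@comp_lfun1r _ _ _) (@comp_lfunDl _ _ _ _)
       (@comp_lfunDr _ _ _ _) ext_id_neq0).

Definition ext_end_lalg : lalgType R[i] :=
  HB.pack 'End(ext R n) ext_end_nzRing
    (GRing.Lmodule_isLalgebra.Build R[i] ext_end_nzRing
       (fun k x y => comp_lfunZl k x y)).

Definition ext_end : algType R[i] :=
  HB.pack 'End(ext R n) ext_end_lalg
    (GRing.Lalgebra_isAlgebra.Build R[i] ext_end_lalg
       (fun k x y => comp_lfunZr k x y)).

End EndAlgebra.

(** * The Lie algebra at a point *)

(** A nonzero row vector in the kernel would contradict positive definiteness. *)
Lemma metric_unit (R : realType) (s : nat) (X : manifold R (2 * s.+1))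
    (K : almost_sKahler X) (c : chart R (2 * s.+1) X) (p : X) :
  atlas c -> cdom c p -> metric K c p \in unitmx.
Proof.
move=> hc hp; have [_ _ /(_ c p hc hp) [_ pos]] := metricP K.
rewrite -row_free_unit; apply: inj_row_free => u uG.
apply/eqP; apply: contraT => /pos.
by rewrite uG mul0mx mxE ltxx.
Qed.

Section AdjointGenerators.
Variables (R : realType) (s : nat) (G : 'M[R]_(2 * s.+1)).
Variable v : 'I_2 -> 'I_s.+1 -> 'rV[R]_(2 * s.+1).
Hypothesis G_unit : G \in unitmx.

(** The operator C_ij, adjoint to the wedge product with v_ij by [herm_wedge]. *)
Definition coframe_contr i j : 'End(ext R (2 * s.+1)) :=
  contr (v i j *m invmx G).

Lemma adj_wedge_comp (u w : 'rV[R]_(2 * s.+1)) x y :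
  herm G ((wedge u \o wedge w)%VF x) y =
  herm G x ((contr (w *m invmx G) \o contr (u *m invmx G))%VF y).
Proof. by rewrite !comp_lfunE !herm_wedge. Qed.

Lemma adj_opL j k : adj G (opL v j k) =
  \sum_i (coframe_contr i k \o coframe_contr i j)%VF.
Proof.
apply: adj_eq => // x y; rewrite /opL !big_ord_recl !big_ord0 !addr0.
by rewrite !add_lfunE hermDl hermDr !adj_wedge_comp.
Qed.

Lemma adj_opV j : adj G (opV v j) =
  (coframe_contr ord_max j \o coframe_contr ord0 j)%VF.
Proof. by apply: adj_eq => // x y; rewrite adj_wedge_comp. Qed.

Lemma sL_generatorsE f : sL_generators G v f <->
  sl_generator (A := ext_end R (2 * s.+1)) (fun i j => wedge (v i j))
    coframe_contr f.
Proof.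
split.
- case=> [[j [k [jk fE]]] | [j fE]]; [left | right].
    by exists j, k; split=> //; case: fE => ->; [left | right; exact: adj_opL].
  by exists j; case: fE => ->; [left | right; rewrite adj_opV].
- case=> [[j [k [jk fE]]] | [j fE]]; [left | right].
    exists j, k; split=> //; case: fE => ->; [by left | right].
    by rewrite adj_opL.
  by exists j; case: fE => ->; [left | right; rewrite adj_opV].
Qed.

End AdjointGenerators.

Lemma lie_subalgebra_smallest (R : realType) (n : nat) (S : set 'End(ext R n)) :
  lie_subalgebra (smallest (@lie_subalgebra R n) S).
Proof.
split=> [P [[]] // | f h Sf Sh P PS | r f Sf P PS | f h Sf Sh P PS];
  have [[_ PD PZ PB] _] := PS.
- by apply: PD; [exact: Sf | exact: Sh].
- by apply: PZ; exact: Sf.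
- by apply: PB; [exact: Sf | exact: Sh].
Qed.

Theorem theorem7p1 (R : realType) (s : nat) (hs : (2 <= s)%N)
  (X : manifold R (2 * s.+1)) (K : almost_sKahler X)
  (p : X) (c : chart R (2 * s.+1) X) (hc : atlas c) (hp : cdom c p)
  (v : 'I_2 -> 'I_s.+1 -> 'rV[R]_(2 * s.+1)) (hv : adapted_coframe K c p v) :
  lie_isomorphic_sl (2 * s + 2) (sL_fibre K c p v).
Proof.
set G := metric K c p; have G_unit : G \in unitmx by exact: metric_unit.
pose A := ext_end R (2 * s.+1).
pose E i j : A := wedge (v i j); pose C i j : A := coframe_contr G v i j.
have EE i j i' j' : E i j * E i' j' = - (E i' j' * E i j).
  exact: wedge_comp.
have CC i j i' j' : C i j * C i' j' = - (C i' j' * C i j).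
  exact: contr_comp.
have CE i j i' j' :
    C i j * E i' j' = ((i == i') && (j == j'))%:R - E i' j' * C i j.
  (* The pairing of v_i'j' with the dual vector of v_ij is their cometric product, a Kronecker delta
     by orthonormality. *)
  apply: etrans (contr_wedge (v i j *m invmx G) (v i' j')) _; congr (_ - _).
  have -> : ((v i j *m invmx G *m (v i' j')^T) 0 0) =
      ((i == i') && (j == j'))%:R by exact: hv.1.
  by case: (_ && _); rewrite ?scale1r ?scale0r.
have [] := @sl_rep_exists R A s E C hs EE CC CE (sL_fibre K c p v).
- exact: lie_subalgebra_smallest.
- move=> f Sf; apply: sub_gen_smallest; exact/sL_generatorsE.
- move=> P P_closed P_gen; apply: (smallest_sub (X := P)) => // f Gf.
  by apply: P_gen; apply/sL_generatorsE.
move=> psi [psi_inj psiS psiD psiZ psi_br]; exists psi; split.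
- split.
  + by move=> M M0; apply/psiS; exists M.
  + by move=> M N _ _; exact: psi_inj.
  + by move=> f /psiS[M M0 <-]; exists M.
- by move=> M N _ _; exact: psiD.
- by move=> r M _; exact: psiZ.
- by move=> M N _ _; exact: psi_br.
Qed.
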